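(* Let $x(\cdot)$ be a bounded solution of $\dot x(t)=f(t,x(t))$ on $[t_0,\infty)$, choose $R>0$ such that $\|x(t)\|\le R$ for all $t\ge t_0$, and let $E_\infty\subset\mathbb{R}^n$ be a nonempty closed set. Suppose that, for all sufficiently large $t$, $$d_R^{\rm AW}(E(t),E_\infty)\le\eta(t)\quad\text{and}\quad\mathrm{dist}(x(t),E(t))\le r(t),$$ where $\eta$ and $r$ are nonnegative functions. Then, for all sufficiently large $t$, $$\mathrm{dist}(x(t),E_\infty)\le\mathrm{dist}(x(t),E(t))+\eta(t)\le r(t)+\eta(t).$$ Consequently, $\mathrm{dist}(x(t),E_\infty)=O(r(t)+\eta(t))$ as $t\to\infty$.
   Context: Fix $t_0\ge 0$ and $f:[t_0,\infty)\times\mathbb{R}^n\to\mathbb{R}^n$ such that $t\mapsto f(t,x)$ is measurable for every $x$ and $x\mapsto f(t,x)$ is locally Lipschitz for a.e. $t\ge t_0$. A solution is a locally absolutely continuous $x:[t_0,\infty)\to\mathbb{R}^n$ with $\dot x(t)=f(t,x(t))$ for a.e. $t\ge t_0$. For nonempty $S$, $\mathrm{dist}(x,S)=\inf_{y\in S}\|x-y\|$. The equilibrium sets are $E(t):=\{x\in\mathbb{R}^n: f(t,x)=0\}$, assumed nonempty and closed for every $t\ge t_0$. For nonempty closed $A,B$ and $R>0$, $d_R^{\rm AW}(A,B):=\sup_{\|z\|\le R}|\mathrm{dist}(z,A)-\mathrm{dist}(z,B)|$. Standing assumption: there is a nonnegative $v_E\in L^1_{\mathrm{loc}}([t_0,\infty))$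 such that for every $R>0$ and $t_0\le s\le t$, $d_R^{\rm AW}(E(t),E(s))\le\int_s^t v_E(\tau)\,d\tau$. *)

(* Defs.v *)
From HB Require Import structures.
From mathcomp Require Import all_boot all_order all_algebra.
From mathcomp Require Import all_classical all_reals all_analysis.
From mathcomp Require Import measurable_realfun.

Set Implicit Arguments.
Unset Strict Implicit.
Unset Printing Implicit Defensive.

Import Order.TTheory GRing.Theory Num.Theory.
Import numFieldNormedType.Exports.

Local Open Scope classical_set_scope.
Local Open Scope ring_scope.

(* The library norm on 'rV[R]_n is the sup norm; distances below are Euclidean.
   Topological notions (closed, nbhs) and derivatives do not depend on this. *)
Definition enorm (R : realType) (n : nat) (x : 'rV[R]_n) : R :=
  Num.sqrt (\sum_(i < n) x ord0 i ^+ 2).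

(* The set is bounded below by 0, so [inf] is the genuine infimum as soon as
   S is nonempty. *)
Definition dist (R : realType) (n : nat) (x : 'rV[R]_n) (S : set 'rV[R]_n) : R :=
  inf [set enorm (x - y) | y in S].

(* For nonempty A and B and 0 < rho, the set is nonempty and bounded above (by
   2 * rho + dist 0 A + dist 0 B), so [sup] is the genuine supremum. *)
Definition dAW (R : realType) (n : nat) (rho : R) (A B : set 'rV[R]_n) : R :=
  sup [set `|dist z A - dist z B| | z in [set z | enorm z <= rho]].

(* Makes [f =O_ +oo g] available. *)
Canonical pinfty_filter_on (R : realType) : filter_on R :=
  FilterType (pinfty_nbhs R) _.

Definition locally_lipschitz (R : realType) (n : nat)
    (g : 'rV[R]_n -> 'rV[R]_n) : Prop :=
  forall x : 'rV[R]_n, exists (U : set 'rV[R]_n) (L : R), nbhs x U /\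
    forall y z, U y -> U z -> enorm (g y - g z) <= L * enorm (y - z).

(* [lebesgue_measure] is defined on Borel sets only; here the domain carries
   the completed (Lebesgue) sigma-algebra. *)
Definition lebesgue_measurable_fun (R : realType) (D : set R) (g : R -> R) : Prop :=
  @measurable_fun _ _
    (g_sigma_algebraType (completed_algebra_gen (@lebesgue_measure R))) R D g.

(* Membership in L^1_loc(D), through a Borel representative. The library's
   [locally_integrable] requires D to be open. *)
Definition loc_integrable_on (R : realType) (D : set R) (v : R -> R) : Prop :=
  forall K, K `<=` D -> compact K ->
    (@lebesgue_measure R).-integrable K (EFin \o v).

Definition abs_continuous_on (R : realType) (n : nat) (a b : R)
    (x : R -> 'rV[R]_n) : Prop :=
  forall e : R, 0 < e -> exists2 d : R, 0 < d &
    forall (m : nat) (l u : 'I_m -> R),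
      (forall i, a <= l i /\ l i <= u i /\ u i <= b) ->
      trivIset [set: 'I_m] (fun i => `]l i, u i[%classic) ->
      \sum_(i < m) (u i - l i) < d ->
      \sum_(i < m) enorm (x (u i) - x (l i)) < e.

(* Vector fields and trajectories are total functions of t; only their values
   for t >= t0 matter. *)
Definition is_solution (R : realType) (n : nat) (t0 : R)
    (f : R -> 'rV[R]_n -> 'rV[R]_n) (x : R -> 'rV[R]_n) : Prop :=
  (forall a b, t0 <= a -> a <= b -> abs_continuous_on a b x) /\
  {ae (@lebesgue_measure R), forall t, t0 <= t ->
     derivable x t 1 /\ derive1 x t = f t (x t)}.

Definition equilibria (R : realType) (n : nat)
    (f : R -> 'rV[R]_n -> 'rV[R]_n) (t : R) : set 'rV[R]_n :=
  [set x | f t x = 0].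

(* Main.v *)
(* The point x(t) lies in the ball over which d_R^AW takes its supremum, so
   |dist(x(t), E(t)) - dist(x(t), E_inf)| <= d_R^AW(E(t), E_inf) <= eta(t).
   The supremum is over a bounded set: comparing with one point of a nonempty set A bounds
   dist(z, A) on the ball. *)
Require Import Defs.
From HB Require Import structures.
From mathcomp Require Import all_boot all_order all_algebra.
From mathcomp Require Import all_classical all_reals all_analysis.
From mathcomp Require Import lra.

Set Implicit Arguments.
Unset Strict Implicit.
Unset Printing Implicit Defensive.

Import Order.TTheory GRing.Theory Num.Theory.
Import numFieldNormedType.Exports.

Local Open Scope classical_set_scope.
Local Open Scope ring_scope.

Lemma normr_le_enorm (R : realType) (n : nat) (x : 'rV[R]_n) (i : 'I_n) :
  `|x ord0 i| <= enorm x.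
Proof.
rewrite -sqrtr_sqr ler_wsqrtr // (bigD1 i) //= lerDl.
by apply: sumr_ge0 => j _; exact: sqr_ge0.
Qed.

(** Expanding the square of a sum of nonnegative terms leaves only nonnegative cross terms beside
    the squares. *)
Lemma enorm_le_sum (R : realType) (n : nat) (x : 'rV[R]_n) :
  enorm x <= \sum_(i < n) `|x ord0 i|.
Proof.
(* Nonnegativity is carried through the induction along with the inequality: it gives the sign of
   the cross term when two partial sums are added. *)
have [s0 sqs] : 0 <= \sum_(i < n) `|x ord0 i| /\
    \sum_(i < n) x ord0 i ^+ 2 <= (\sum_(i < n) `|x ord0 i|) ^+ 2.
  elim/big_ind2: _ => [|a1 a2 b1 b2 [a0 ha] [b0 hb]|i _].
  - by rewrite expr0n.
  - by split; [exact: addr_ge0 | nra].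
  - by rewrite normr_ge0 real_normK ?num_real.
by rewrite -(ger0_norm s0) -sqrtr_sqr ler_wsqrtr.
Qed.

Lemma dist_ge0 (R : realType) (n : nat) (z : 'rV[R]_n) (A : set 'rV[R]_n) :
  A !=set0 -> 0 <= dist z A.
Proof.
move=> [a Aa]; apply: lb_le_inf; first by exists (enorm (z - a)), a.
by move=> _ [y _ <-]; exact: sqrtr_ge0.
Qed.

Lemma dist_le (R : realType) (n : nat) (z a : 'rV[R]_n) (A : set 'rV[R]_n) :
  A a -> dist z A <= enorm (z - a).
Proof.
move=> Aa; apply: ge_inf; last by exists a.
by exists 0 => _ [y _ <-]; exact: sqrtr_ge0.
Qed.

(** Passing to the sum of absolute coordinates lets the triangle inequality be used in each
    coordinate separately, so none for [enorm] is required. *)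
Lemma dist_bounded_on_ball (R : realType) (n : nat) (rho : R)
    (A : set 'rV[R]_n) : A !=set0 ->
  exists M, forall z, enorm z <= rho -> dist z A <= M.
Proof.
move=> [a Aa]; exists (\sum_(i < n) (rho + `|a ord0 i|)) => z zrho.
apply: (le_trans (dist_le z Aa)); apply: (le_trans (enorm_le_sum _)).
apply: ler_sum => i _; rewrite !mxE; apply: (le_trans (ler_normB _ _)).
by rewrite lerD2r (le_trans (normr_le_enorm z i)).
Qed.

Lemma dist_dAW (R : realType) (n : nat) (rho : R) (A B : set 'rV[R]_n)
    (z : 'rV[R]_n) : A !=set0 -> B !=set0 -> enorm z <= rho ->
  `|dist z A - dist z B| <= dAW rho A B.
Proof.
move=> A0 B0 zrho; apply: ub_le_sup; last by exists z.
have [MA hA] := dist_bounded_on_ball rho A0.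
have [MB hB] := dist_bounded_on_ball rho B0.
(* Crude but sufficient: a difference of two nonnegative distances is bounded by their sum. *)
exists (MA + MB) => _ [y yrho <-].
apply: (le_trans (ler_normB _ _)).
by rewrite !ger0_norm ?dist_ge0// lerD ?hA ?hB.
Qed.

Theorem theorem5p9 (R : realType) (n : nat) (t0 : R) (t0_ge0 : 0 <= t0)
  (f : R -> 'rV[R]_n -> 'rV[R]_n)
  (f_meas : forall (x : 'rV[R]_n) (i : 'I_n),
     lebesgue_measurable_fun `[t0, +oo[ (fun t => f t x ord0 i))
  (f_lip : {ae (@lebesgue_measure R), forall t, t0 <= t ->
     locally_lipschitz (f t)})
  (E_neq0 : forall t, t0 <= t -> equilibria f t !=set0)
  (E_closed : forall t, t0 <= t -> closed (equilibria f t))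
  (vE : R -> R)
  (vE_ge0 : forall t, t0 <= t -> 0 <= vE t)
  (vE_int : loc_integrable_on `[t0, +oo[ vE)
  (E_AW : forall rho s t : R, 0 < rho -> t0 <= s -> s <= t ->
     dAW rho (equilibria f t) (equilibria f s)
       <= \int[@lebesgue_measure R]_(tau in `[s, t]) vE tau)
  (x : R -> 'rV[R]_n) (x_sol : is_solution t0 f x)
  (rho : R) (rho_gt0 : 0 < rho)
  (x_bnd : forall t, t0 <= t -> enorm (x t) <= rho)
  (Einf : set 'rV[R]_n) (Einf_neq0 : Einf !=set0) (Einf_closed : closed Einf)
  (eta r : R -> R)
  (eta_ge0 : forall t, t0 <= t -> 0 <= eta t)
  (r_ge0 : forall t, t0 <= t -> 0 <= r t)
  (E_cvg : \forall t \near +oo,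
     dAW rho (equilibria f t) Einf <= eta t /\
     dist (x t) (equilibria f t) <= r t) :
  (\forall t \near +oo,
     dist (x t) Einf <= dist (x t) (equilibria f t) + eta t /\
     dist (x t) (equilibria f t) + eta t <= r t + eta t) /\
  (fun t => dist (x t) Einf : R^o) =O_ +oo (fun t => r t + eta t : R^o).
Proof.
have near_bound : \forall t \near +oo,
    dist (x t) Einf <= dist (x t) (equilibria f t) + eta t /\
    dist (x t) (equilibria f t) + eta t <= r t + eta t.
  near=> t.
  have t0t : t0 <= t by near: t; exact: nbhs_pinfty_ge (num_real _).
  have [AWeta distr] : dAW rho (equilibria f t) Einf <= eta t /\
    dist (x t) (equilibria f t) <= r t by near: t.
  split; last by rewrite lerD2r.
  (* Only one side of the absolute value matters: the excess of the distance to [Einf] over the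
     distance to the equilibrium set. *)
  rewrite -lerBlDl; apply: le_trans AWeta.
  apply: le_trans (dist_dAW (E_neq0 t t0t) Einf_neq0 (x_bnd t t0t)).
  by rewrite distrC ler_norm.
(* The constant is 1, since the chain of inequalities just proved loses no factor; the norms in the
   definition of O are removed by [dist_ge0] on the left and [ler_norm] on the right. *)
split => //; apply/eqO_exP; exists 1 => //; near=> t.
have [h1 h2] : dist (x t) Einf <= dist (x t) (equilibria f t) + eta t /\
    dist (x t) (equilibria f t) + eta t <= r t + eta t by near: t.
rewrite mul1r ger0_norm ?dist_ge0//.
exact: le_trans (le_trans h1 h2) (ler_norm _).
Unshelve. all: by end_near.
Qed.
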